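(* Let $K$ be a division ring, $S$ a ring endomorphism of $K$, $D$ an $S$-derivation of $K$ and $R=K[t;S,D]$. Let $g,h\in R$ be fully reducible polynomials (resp. Wedderburn polynomials) of degrees $l\ge 1$ and $n\ge 1$ respectively, and let $g=p_r\cdots p_1$, $h=q_s\cdots q_1$ be factorizations into monic polynomials of $R$ of positive degree (resp. $g=(t-b_l)\cdots(t-b_1)$ and $h=(t-a_n)\cdots(t-a_1)$ with $a_i,b_j\in K$). Let $U=e_{n1}\in M_{n\times l}(K)$ be the matrix with $1$ in the bottom left corner and $0$ elsewhere. Then the following are equivalent: (1) $gh$ is a fully reducible (resp. Wedderburn) polynomial. (2) $1\in Rg+hR$. (3) There exists a matrix $X\in M_{n\times l}(K)$ such that $C_hX-S(X)C_g-D(X)=U$. (4) There exists $Y\in M_{n\times l}(K)$ such that $$C_h(q_s,\dots,q_1)\,Y-S(Y)\,C_g(p_r,\dots,p_1)-D(Y)=U$$ (resp. $C_h(a_n,\dots,a_1)\,Y-S(Y)\,C_g(b_l,\dots,b_1)-D(Y)=U$).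
   Context: An $S$-derivation is an additive map $D:K\to K$ with $D(ab)=S(a)D(b)+D(a)b$. $R=K[t;S,D]$ is the Ore ring of skew polynomials $\sum a_it^i$ ($a_i\in K$) with $ta=S(a)t+D(a)$. $S$ and $D$ are extended entrywise to matrices. For $f\in R$, $a\in K$ write $f=q\,(t-a)+b$ with $q\in R$, $b\in K$; then $f(a):=b$, and $V(f):=\{a\in K: f(a)=0\}$. A polynomial $f\in R$ is a Wedderburn polynomial if $f$ is monic and is of minimal degree amongst the nonzero polynomials of $R$ vanishing on $V(f)$. A monic polynomial $f\in R$ is fully reducible if there are irreducible polynomials $p_1,\dots,p_m\in R$ with $Rf=\bigcap_{i=1}^m Rp_i$. For a monic polynomial $f=t^n+\sum_{i=0}^{n-1}a_it^i$, the companion matrix $C_f\in M_n(K)$ has $1$'s in positions $(i,i+1)$, $1\le i\le n-1$, last row $(-a_0,-a_1,\dots,-a_{n-1})$, and all other entries $0$. For $g=p_r\cdots p_1$ with $p_i$ monic of degree $n_i$, $C_g(p_r,\dots,p_1)$ is the block upper triangular matrix with diagonal blocks $C_{p_1},C_{p_2},\dots,C_{p_r}$ (in this order from the top left), with blocks $U_i\in M_{n_i\times n_{i+1}}(K)$ in block positions $(i,i+1)$, $1\le i\le r-1$, where $U_i$ has a $1$ in its bottom left corner and $0$ elsewhere, and all other blocks $0$. In particular for $g=(t-a_r)\cdots(t-a_1)$, $C_g(a_r,\dots,a_1)$ is the $r\times r$ matrix with diagonal entries $a_1,\dots,a_r$, $1$'s in positions $(i,i+1)$, and $0$ elsewhere.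 *)

(* Defs.v *)
From HB Require Import structures.
From mathcomp Require Import all_boot all_order all_algebra.

Set Implicit Arguments.
Unset Strict Implicit.
Unset Printing Implicit Defensive.

Import GRing.Theory.
Local Open Scope ring_scope.

(* MathComp has no structure of (noncommutative) division rings. *)
Definition is_division_ring (K : unitRingType) : Prop :=
  forall x : K, x != 0 -> x \is a GRing.unit.

Record sderivation (K : nzRingType) (S : K -> K) := SDerivation {
  sder_additive :> {additive K -> K};
  sderM : forall a b,
    sder_additive (a * b) = S a * sder_additive b + sder_additive a * b
}.

(* K[t;S,D]: the element \sum_i a_i t^i is stored as the sequence of its left *)
(* coefficients a_i, i.e. on the carrier of {poly K}, whose additive          *)
(* structure is reused; the multiplication is the skew one defined below.     *)
Definition ore (K : nzRingType) (S : {rmorphism K -> K}) (D : sderivation S) :=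
  {poly K}.

HB.instance Definition _ (K : nzRingType) (S : {rmorphism K -> K})
  (D : sderivation S) := GRing.Zmodule.on (@ore K S D).

Section OreRing.
Variables (K : nzRingType) (S : {rmorphism K -> K}) (D : sderivation S).
Implicit Types (a b c : K) (f g h : {poly K}).

(* Left multiplication by t: t * (a_i t^i) = S(a_i) t^(i+1) + D(a_i) t^i. *)
Definition ore_tmul f : {poly K} := map_poly S f * 'X + map_poly D f.

Definition ore_mul f g : {poly K} :=
  \sum_(i < size f) f`_i *: iter i ore_tmul g.

Lemma coef_ore_tmul f i :
  (ore_tmul f)`_i = (if i is j.+1 then S f`_j else 0) + D f`_i.
Proof.
by rewrite coefD coefMX !coef_map_id0 ?raddf0 //; case: i => //= i; rewrite coef_map_id0 ?raddf0.
Qed.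

Lemma ore_tmulD f g : ore_tmul (f + g) = ore_tmul f + ore_tmul g.
Proof.
apply/polyP=> i; rewrite coefD !coef_ore_tmul !coefD raddfD addrACA.
by congr (_ + _); case: i => [|i]; rewrite ?addr0 // coefD raddfD.
Qed.

Lemma ore_tmulZ a f : ore_tmul (a *: f) = S a *: ore_tmul f + D a *: f.
Proof.
apply/polyP=> i; rewrite coef_ore_tmul coefD !coefZ coef_ore_tmul sderM mulrDr addrA.
by congr (_ + _ + _); case: i => [|i]; rewrite ?mulr0 // coefZ rmorphM.
Qed.

Lemma ore_tmul0 : ore_tmul 0 = 0.
Proof. by apply: (addIr (ore_tmul 0)); rewrite -ore_tmulD !add0r. Qed.

Lemma ore_tmul_sum I (r : seq I) (P : pred I) (F : I -> {poly K}) :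
  ore_tmul (\sum_(i <- r | P i) F i) = \sum_(i <- r | P i) ore_tmul (F i).
Proof. exact: (big_morph _ ore_tmulD ore_tmul0). Qed.

Lemma iter_ore_tmulD i f g :
  iter i ore_tmul (f + g) = iter i ore_tmul f + iter i ore_tmul g.
Proof. by elim: i => //= i ->; rewrite ore_tmulD. Qed.

Lemma ore_mul_wide n f g : (size f <= n)%N ->
  ore_mul f g = \sum_(i < n) f`_i *: iter i ore_tmul g.
Proof.
move=> le_fn; rewrite /ore_mul (big_ord_widen n (fun i => f`_i *: iter i _ g)) //.
rewrite big_mkcond; apply: eq_bigr => i _; case: ltnP => // le_fi.
by rewrite nth_default ?scale0r.
Qed.

Lemma ore_mulDl f g h : ore_mul (f + g) h = ore_mul f h + ore_mul g h.
Proof.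
pose n := maxn (size f) (size g).
rewrite !(@ore_mul_wide n) ?leq_maxl ?leq_maxr ?size_polyD // -big_split.
by apply: eq_bigr => i _; rewrite coefD scalerDl.
Qed.

Lemma ore_mulDr f g h : ore_mul f (g + h) = ore_mul f g + ore_mul f h.
Proof.
rewrite -big_split; apply: eq_bigr => i _.
by rewrite iter_ore_tmulD scalerDr.
Qed.

Lemma ore_mulZl a f g : ore_mul (a *: f) g = a *: ore_mul f g.
Proof.
rewrite (ore_mul_wide _ (size_scale_leq a f)) scaler_sumr.
by apply: eq_bigr => i _; rewrite coefZ scalerA.
Qed.

Lemma ore_mul0l g : ore_mul 0 g = 0.
Proof. by rewrite /ore_mul size_poly0 big_ord0. Qed.

Lemma ore_mul_suml I (r : seq I) (P : pred I) (F : I -> {poly K}) g :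
  ore_mul (\sum_(i <- r | P i) F i) g = \sum_(i <- r | P i) ore_mul (F i) g.
Proof.
exact: (big_morph (fun f => ore_mul f g)
          (fun f h => ore_mulDl f h g) (ore_mul0l g)).
Qed.

Lemma ore_mulXn i g : ore_mul 'X^i g = iter i ore_tmul g.
Proof.
rewrite /ore_mul size_polyXn big_ord_recr /= coefXn eqxx scale1r.
rewrite big1 ?add0r // => j _.
by rewrite coefXn (ltn_eqF (ltn_ord j)) scale0r.
Qed.

Lemma ore_tmulXn i : ore_tmul 'X^i = 'X^(i.+1).
Proof.
have D1 : D 1 = 0.
  by apply: (addrI (D 1)); rewrite addr0 -{3}[1]mulr1 sderM rmorph1 mul1r mulr1.
apply/polyP=> j; rewrite coef_ore_tmul !coefXn.
have -> : D (j == i)%:R = 0 by case: eqP => _; rewrite ?raddf0.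
by rewrite addr0; case: j => [|j] //; rewrite coefXn eqSS rmorph_nat.
Qed.

Lemma ore_tmul_mul f g : ore_mul (ore_tmul f) g = ore_tmul (ore_mul f g).
Proof.
rewrite [in LHS](_ : f = \sum_(i < size f) f`_i *: 'X^i); last first.
  by rewrite -[LHS]coefK poly_def.
rewrite ore_tmul_sum ore_mul_suml ore_tmul_sum; apply: eq_bigr => i _.
rewrite !ore_tmulZ ore_tmulXn ore_mulDl !ore_mulZl.
by rewrite !ore_mulXn.
Qed.

Lemma ore_mulA : associative ore_mul.
Proof.
move=> f g h; rewrite {2}/ore_mul ore_mul_suml; apply: eq_bigr => i _.
rewrite ore_mulZl; congr (_ *: _).
by elim: (nat_of_ord i) => //= j ->; rewrite ore_tmul_mul.
Qed.

Lemma ore_mul1l : left_id 1 ore_mul.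
Proof. by move=> g; rewrite -(expr0 'X) ore_mulXn. Qed.

Lemma ore_mul1r : right_id 1 ore_mul.
Proof.
move=> f; rewrite -[RHS]coefK poly_def; apply: eq_bigr => i _.
congr (_ *: _); rewrite -(expr0 'X); elim: (nat_of_ord i) => //= j ->.
exact: ore_tmulXn.
Qed.

Lemma ore_one_neq0 : 1 != 0 :> {poly K}.
Proof. exact: oner_neq0. Qed.

HB.instance Definition _ := GRing.Zmodule_isNzRing.Build (ore D)
  ore_mulA ore_mul1l ore_mul1r ore_mulDl ore_mulDr ore_one_neq0.

End OreRing.

Section OreTheory.
Variables (K : nzRingType) (S : {rmorphism K -> K}) (D : sderivation S).

Definition oreC (a : K) : ore D := a%:P.
Definition oreX : ore D := 'X%R.
Definition deg (f : ore D) : nat := (size (f : {poly K})).-1.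
Definition ore_monic (f : ore D) : bool := (f : {poly K}) \is monic.

Lemma ore_mulE (f g : ore D) : f * g = ore_mul D f g.
Proof. by []. Qed.

Lemma oreCM (a : K) (f : ore D) : oreC a * f = (a *: (f : {poly K})).
Proof.
rewrite ore_mulE /oreC -[a%:P]alg_polyC ore_mulZl.
by rewrite ore_mul1l.
Qed.

Lemma oreCD (a b : K) : oreC (a + b) = oreC a + oreC b.
Proof. exact: polyCD. Qed.

Lemma oreC_mul (a b : K) : oreC (a * b) = oreC a * oreC b.
Proof. by rewrite oreCM /oreC -mul_polyC polyCM. Qed.

Lemma oreXM (f : ore D) : oreX * f = ore_tmul D f.
Proof. by rewrite ore_mulE /oreX -['X]expr1 ore_mulXn. Qed.

Lemma oreXC (a : K) : oreX * oreC a = oreC (S a) * oreX + oreC (D a).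
Proof.
by rewrite oreXM oreCM /ore_tmul /oreC !map_polyC mul_polyC.
Qed.

Lemma ore_sumE (f : ore D) :
  f = \sum_(i < size (f : {poly K})) oreC (f : {poly K})`_i * oreX ^+ i.
Proof.
have XnE i : oreX ^+ i = 'X^i :> {poly K}.
  elim: i => [|i IH]; first by rewrite expr0.
  rewrite exprS oreXM -(ore_tmulXn D); congr (ore_tmul D _); exact: IH.
rewrite -[LHS](coefK (f : {poly K})) poly_def.
by apply: eq_bigr => i _; rewrite oreCM; congr (_ *: _); rewrite -XnE.
Qed.

Lemma size_ore_mul (f g : ore D) : f != 0 -> ore_monic g ->
  size (f * g : {poly K}) = (size (f : {poly K}) + deg g)%N
  /\ lead_coef (f * g : {poly K}) = lead_coef (f : {poly K}).
Proof.
rewrite /deg /ore_monic => f0 g_monic.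
have S1 i : let u := iter i (ore_tmul D) g in
    size u = (i + size (g : {poly K}))%N /\ u \is monic.
  elim: i => //= i; set u := iter i _ _ => -[su mu].
  have mSu : map_poly S u \is monic.
    apply/monicP; rewrite lead_coef_map_id0 ?(monicP mu) ?rmorph1 ?raddf0 ?oner_neq0 //.
  have sSu : size (map_poly S u) = size u.
    by rewrite size_map_poly_id0 // (monicP mu) rmorph1 oner_neq0.
  have sSX : size (map_poly S u * 'X) = (size u).+1.
    by rewrite size_mulX ?sSu // monic_neq0.
  have lt : (size (map_poly D u) < size (map_poly S u * 'X)%R)%N.
    by rewrite sSX ltnS size_poly.
  rewrite /ore_tmul size_polyDl // sSX su; split=> //.
  by apply/monicP; rewrite lead_coefDl // lead_coefMX (monicP mSu).
have sg : (0 < size (g : {poly K}))%N by rewrite size_poly_gt0 monic_neq0.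
rewrite ore_mulE /ore_mul.
have: (0 < size (f : {poly K}))%N by rewrite size_poly_gt0.
case sf: (size (f : {poly K})) => [//|m] _.
have [su mu] := S1 m.
have lc : lead_coef (f : {poly K}) = (f : {poly K})`_m.
  by rewrite lead_coefE sf.
have lc0 : (f : {poly K})`_m != 0 by rewrite -lc lead_coef_eq0.
have stop : size ((f : {poly K})`_m *: iter m (ore_tmul D) g)
            = (m + size (g : {poly K}))%N.
  rewrite -mul_polyC size_proper_mul ?su ?size_polyC ?lc0 ?add1n //.
  by rewrite lead_coefC (monicP mu) mulr1.
rewrite big_ord_recr /= addrC; set A := _ *: _; set B := \sum_(i < m) _.
have ltB : (size B < size A)%N.
  rewrite stop -(prednK sg) addnS ltnS.
  apply: leq_trans (size_sum _ _ _) _; apply/bigmax_leqP => i _.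
  apply: leq_trans (size_scale_leq _ _) _; have [-> _] := S1 i.
  by rewrite -ltnS -[(m + _).+1]addnS prednK // ltn_add2r.
rewrite size_polyDl // lead_coefDl // stop; split.
  by rewrite -[in LHS](prednK sg) addnS addSn.
rewrite lc lead_coefE stop /A coefZ -[RHS]mulr1; congr (_ * _).
by rewrite -(monicP mu) lead_coefE su.
Qed.

Lemma ore_monicM (f g : ore D) : ore_monic f -> ore_monic g ->
  ore_monic (f * g) /\ deg (f * g) = (deg f + deg g)%N.
Proof.
move=> mf mg; have f0 : f != 0 by exact: (monic_neq0 mf).
have [sfg lfg] := size_ore_mul f0 mg; split.
  by apply/monicP; rewrite lfg (monicP mf).
rewrite {1}/deg sfg /deg.
have : (0 < size (f : {poly K}))%N by rewrite size_poly_gt0.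
by case: (size _).
Qed.

Lemma ore_monic_deg_prod r (p : 'I_r -> ore D) :
  (forall i, ore_monic (p i)) ->
  ore_monic (\prod_(i < r) p (rev_ord i)) /\
  deg (\prod_(i < r) p (rev_ord i)) = (\sum_(i < r) deg (p i))%N.
Proof.
move=> mp; rewrite (reindex_inj rev_ord_inj) /=.
apply: (big_rec2 (fun f n => ore_monic f /\ deg f = n)).
  by split; [exact: monic1 | rewrite /deg size_poly1].
move=> i n f _ [mf <-]; have [? ->] := ore_monicM (mp (rev_ord i)) mf.
by split.
Qed.

(* [skew_eval f a b] is f(a) = b; skew_eval_unique shows f(a) well defined.    *)
Definition skew_eval (f : ore D) (a b : K) : Prop :=
  exists q : ore D, f = q * (oreX - oreC a) + oreC b.

Lemma skew_eval_unique (f : ore D) (a : K) : exists! b, skew_eval f a b.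
Proof.
have mXa : ore_monic (oreX - oreC a) by exact: monicXsubC.
have ex_eval g : exists b, skew_eval g a b.
  rewrite [g]ore_sumE; elim/big_rec: _ => [|i h _ [c [q ->]]].
    by exists 0, 0; rewrite mul0r /oreC polyC0 add0r.
  have [d [q' ->]] : exists d, skew_eval (oreX ^+ i) a d.
    elim: {h} (nat_of_ord i) => [|j [d [q' IH]]].
      by exists 1, 0; rewrite expr0 mul0r add0r.
    exists (S d * a + D d), (oreX * q' + oreC (S d)).
    rewrite exprS IH mulrDr oreXC mulrA mulrDl oreCD oreC_mul -addrA.
    by congr (_ + _); rewrite mulrBr -!addrA addKr.
  exists ((g : {poly K})`_i * d + c), (oreC (g : {poly K})`_i * q' + q).
  by rewrite oreCD oreC_mul mulrDr mulrDl mulrA addrACA.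
have [b eb] := ex_eval f; exists b; split=> // c [q' fq'].
have [q fq] := eb.
have e : (q - q') * (oreX - oreC a) = oreC (c - b).
  rewrite mulrBl /oreC polyCB; apply/eqP.
  by rewrite subr_eq addrAC -subr_eq opprK [_ + q' * _]addrC -fq' -fq.
apply/esym/eqP; rewrite -subr_eq0; have [q0|q0] := eqVneq (q - q') 0.
  by move/esym: e; rewrite q0 mul0r => /eqP; rewrite polyC_eq0.
have [sz _] := size_ore_mul q0 mXa; move: sz.
have -> : deg (oreX - oreC a) = 1%N by rewrite /deg size_XsubC.
rewrite e => sz; have := size_polyC_leq1 (c - b).
by rewrite [size _]sz addn1 ltnS leqn0 size_poly_eq0 (negPf q0).
Qed.

Definition vanishes_at (f : ore D) (a : K) : Prop := skew_eval f a 0.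

Definition wedderburn (f : ore D) : Prop :=
  ore_monic f /\
  forall g : ore D, g != 0 ->
    (forall a, vanishes_at f a -> vanishes_at g a) -> (deg f <= deg g)%N.

Definition ore_unit (u : ore D) : Prop := exists v, u * v = 1 /\ v * u = 1.

Definition ore_irreducible (p : ore D) : Prop :=
  [/\ p != 0, ~ ore_unit p &
      forall a b : ore D, p = a * b -> ore_unit a \/ ore_unit b].

(* Membership in the left ideal Rf. *)
Definition in_left_ideal (f x : ore D) : Prop := exists q : ore D, x = q * f.

Definition fully_reducible (f : ore D) : Prop :=
  ore_monic f /\
  exists (m : nat) (p : 'I_m -> ore D),
    (forall i, ore_irreducible (p i)) /\
    (forall x, in_left_ideal f x <-> forall i, in_left_ideal (p i) x).

Definition corner_mx m n : 'M[K]_(m, n) :=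
  \matrix_(i, j) ((i.+1 == m) && (j == 0 :> nat))%:R.

Definition companion (f : ore D) : 'M[K]_(deg f) :=
  \matrix_(i, j) (if i.+1 == deg f then - (f : {poly K})`_j
                  else (j == i.+1 :> nat)%:R).

(* C_g(p_r, ..., p_1), with p_1, ..., p_r indexed from 0 as p 0, ..., p (r-1). *)
(* When the p_i are monic with product g, the size \sum_i deg (p i) is deg g  *)
(* (ore_monic_deg_prod).                                                      *)
Definition block_companion r (p : 'I_r -> ore D) :
    'M[K]_(\sum_i deg (p i)) :=
  \mxdiag_i companion (p i) +
  \mxblock_(i, j) (if j == i.+1 :> nat then corner_mx (deg (p i)) (deg (p j))
                   else 0).

(* C_g(a_r, ..., a_1). *)
Definition linear_companion r (a : 'I_r -> K) : 'M[K]_r :=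
  \matrix_(i, j) (a i *+ (i == j) + (j == i.+1 :> nat)%:R).

End OreTheory.

Arguments oreX {K S D}.
Arguments oreC {K S D}.

(* Main.v *)
Require Import Defs.
From HB Require Import structures.
From Stdlib Require Import Classical.
From mathcomp Require Import all_boot all_order all_algebra.

Set Implicit Arguments.
Unset Strict Implicit.
Unset Printing Implicit Defensive.

Import GRing.Theory.
Local Open Scope ring_scope.

(** Write R for the Ore ring K[t;S,D]; the proof reads everything off the
    cyclic left modules R/Rf.

    Division on the right by a nonzero polynomial is possible because K is a
    division ring, so left ideals are principal and the irreducible
    polynomials are the generators of the maximal left ideals
    ([irreducible_maximal]).  A monic f is fully reducible exactly when R/Rf is
    semisimple.  Right multiplication by h gives an exact sequence
      0 -> R/Rg -> R/Rgh -> R/Rh -> 0,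
    whose ends are semisimple by assumption, so the middle is semisimple if and
    only if the sequence splits.  A splitting sends the class of 1 to some
    w = 1 - xh with hw in Rgh, that is h(1 - xh) = ygh; cancelling h on the
    right gives yg + hx = 1.  The two directions are
    [coprime_of_fully_reducible_mul], where the splitting is found by a greedy
    choice among the maximal left ideals that intersect in Rgh, and
    [fully_reducible_mul]: if ug + hv = 1, then z lies in Rgh if and only if z
    lies in Rh and zv lies in Rg, which displays Rgh as an intersection of
    maximal left ideals.

    A Wedderburn polynomial is a monic f such that Rf is the intersection of
    the R(t - a), for a in V(f).  Finitely many a suffice, so Wedderburn
    polynomials are fully reducible, and (1) => (2) is inherited.  For the
    converse, {z : zv in R(t - a)} is all of R or again of the form R(t - a'),
    where a' is an (S,D)-conjugate of a ([linear_factor_pullback]).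

    The matrix equations are handled all at once.  Call a column e of monic
    polynomials e_0, e_1, ..., e_(n-1), with e_i of degree i, a frame of f for
    the matrix A if t e = A e modulo the last-row correction f; then e is a
    K-basis of R/Rf on which t acts by A.  The companion matrix, its block
    version and its bidiagonal version are such matrices A for three choices
    of the basis.  Given frames e of h for A and e' of g for B, put z = X e', a
    column over R/Rg.  The equation A X - S(X) B - D(X) = U says that A z - t z
    is the last unit column over R/Rg.  The rows but the last force
    z_i = e_i z_0, and the last row then reads - h z_0 = 1 in R/Rg.  So the
    equation is solvable if and only if 1 lies in Rg + hR
    ([coprime_frame_equation]), whatever the frames: this is (2) <=> (3) and
    (2) <=> (4). *)

Notation osize f := (size (polyseq (f%R : ore _))) (only parsing).

(** * Coefficients and sizes *)

Section CoefficientEmbedding.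
Variables (K : nzRingType) (S : {rmorphism K -> K}) (D : sderivation S).

Fact oreC_is_zmod_morphism : zmod_morphism (@oreC K S D).
Proof. exact: polyCB. Qed.

Fact oreC_is_monoid_morphism : monoid_morphism (@oreC K S D).
Proof. by split=> [|a b]; last exact: oreC_mul. Qed.

HB.instance Definition _ :=
  GRing.isZmodMorphism.Build K (ore D) (@oreC K S D) oreC_is_zmod_morphism.
HB.instance Definition _ :=
  GRing.isMonoidMorphism.Build K (ore D) (@oreC K S D) oreC_is_monoid_morphism.

Lemma size_oreXM (f : ore D) n : (osize f <= n)%N ->
  (osize (oreX * f) <= n.+1)%N.
Proof.
move=> le_fn; rewrite oreXM /ore_tmul; apply: leq_trans (size_polyD _ _) _.
rewrite geq_max; apply/andP; split; last first.
  by apply: leq_trans (size_poly _ _) _; apply: leqW.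
apply: leq_trans (size_polyMleq _ _) _; rewrite size_polyX addn2 /=.
by rewrite ltnS; apply: leq_trans (size_poly _ _) le_fn.
Qed.

Lemma size_ore_mulC (f : ore D) c : (osize (f * oreC c) <= osize f)%N.
Proof.
rewrite [f in f * _]ore_sumE mulr_suml; apply: leq_trans (size_sum _ _ _) _.
apply/bigmax_leqP => i _; rewrite -mulrA oreCM.
apply: leq_trans (size_scale_leq _ _) _; apply: leq_trans (ltn_ord i).
elim: (nat_of_ord i) => [|j IHj]; first by rewrite expr0 mul1r size_polyC_leq1.
by rewrite exprS -mulrA; apply: size_oreXM.
Qed.

Lemma size_oreCM c (f : ore D) : (osize (oreC c * f) <= osize f)%N.
Proof. by rewrite oreCM size_scale_leq. Qed.

Lemma osize_monic (f : ore D) : ore_monic f -> osize f = (deg f).+1.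
Proof.
by move=> mf; rewrite /deg prednK // size_poly_gt0 monic_neq0.
Qed.

Lemma monic_ore_neq0 (f : ore D) : ore_monic f -> f != 0.
Proof. exact: monic_neq0. Qed.

Lemma monic_oreXsubC a : ore_monic (oreX - oreC a : ore D).
Proof. exact: monicXsubC. Qed.

Lemma osize_XsubC a : osize (oreX - oreC a : ore D) = 2.
Proof. exact: size_XsubC. Qed.
End CoefficientEmbedding.

(** * Division and left ideals over a division ring *)

Section OreOverDivisionRing.
Variables (K : unitRingType) (K_div : is_division_ring K).
Variables (S : {rmorphism K -> K}) (D : sderivation S).
Implicit Types (f g h p q d x y z u v : ore D) (a b c : K) (I : ore D -> Prop).

Lemma oreC_unit c : c != 0 -> oreC c^-1 * oreC c = 1 :> ore D
  /\ oreC c * oreC c^-1 = 1 :> ore D.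
Proof. by move=> /K_div Uc; rewrite -!oreC_mul mulVr ?mulrV. Qed.

Lemma osize_mulC f c : c != 0 -> osize (f * oreC c) = osize f.
Proof.
move=> c0; apply/eqP; rewrite eqn_leq size_ore_mulC /=.
have [_ cV] := oreC_unit c0.
by rewrite -[f in leqLHS]mulr1 -cV mulrA size_ore_mulC.
Qed.

(** Multiplicativity of degrees and division are easy for a monic right
    factor; this reduces the general case to that one. *)
Lemma monic_multiple g : g != 0 ->
  exists c g', [/\ c != 0, ore_monic g', osize g' = osize g & g = oreC c * g'].
Proof.
move=> g0; set c := lead_coef (g : {poly K}).
have c0 : c != 0 by rewrite lead_coef_eq0.
have [cV Vc] := oreC_unit c0.
have sz : osize (oreC c^-1 * g) = osize g.
  apply/eqP; rewrite eqn_leq size_oreCM /=.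
  by rewrite -[g in leqLHS]mul1r -Vc -mulrA size_oreCM.
exists c, (oreC c^-1 * g); split=> //; last by rewrite mulrA Vc mul1r.
rewrite /ore_monic monicE lead_coefE sz oreCM coefZ -lead_coefE.
by rewrite mulVr ?K_div.
Qed.

Lemma osizeM f g : f != 0 -> g != 0 -> osize (f * g) = (osize f + osize g).-1.
Proof.
move=> f0 /monic_multiple[c [g' [c0 mg' <- ->]]]; rewrite mulrA.
have fc0 : f * oreC c != 0 by rewrite -size_poly_gt0 osize_mulC // size_poly_gt0.
have [-> _] := size_ore_mul fc0 mg'.
by rewrite osize_mulC // (osize_monic mg') addnS.
Qed.

Lemma ore_mul_neq0 f g : f != 0 -> g != 0 -> f * g != 0.
Proof.
move=> f0 g0; rewrite -size_poly_gt0 osizeM //.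
move: f0 g0; rewrite -!size_poly_gt0.
by case: (osize f) => // m; case: (osize g) => // n _ _; rewrite addnS.
Qed.

Lemma ore_mulIf h f g : h != 0 -> f * h = g * h -> f = g.
Proof.
move=> h0 eq_fg; apply/eqP; rewrite -subr_eq0; apply: contraT => fg0.
by have := ore_mul_neq0 fg0 h0; rewrite mulrBl eq_fg subrr eqxx.
Qed.

Lemma ore_divides_monic g f : ore_monic g ->
  exists q r, f = q * g + r /\ (osize r < osize g)%N.
Proof.
move=> mg; elim: {f}(osize f).+1 {-2}f (leqnn (osize f).+1) => // n IHn f.
rewrite ltnS => le_fn; have [lt_fg|le_gf] := ltnP (osize f) (osize g).
  by exists 0, f; rewrite mul0r add0r.
have g0 := monic_ore_neq0 mg.
have f0 : f != 0.
  rewrite -size_poly_gt0; by apply: leq_trans le_gf; rewrite (osize_monic mg).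
pose c := lead_coef (f : {poly K}); pose q0 : ore D := c *: 'X^(osize f - osize g).
have c0 : c != 0 by rewrite lead_coef_eq0.
have sq0 : osize q0 = (osize f - osize g).+1.
  rewrite /q0 -mul_polyC size_proper_mul ?size_polyC ?c0 ?size_polyXn //.
  by rewrite lead_coefC lead_coefXn mulr1.
have lq0 : lead_coef (q0 : {poly K}) = c.
  by rewrite lead_coefE sq0 coefZ coefXn eqxx mulr1.
have q00 : q0 != 0 by rewrite -size_poly_gt0 sq0.
have [sM lM] := size_ore_mul q00 mg.
have sM' : osize (q0 * g) = osize f.
  by rewrite sM sq0 addSn -addnS -(osize_monic mg) subnK.
have lt : (osize (f - q0 * g) < osize f)%N.
  case sf: (osize f) => [|m]; first by move: f0; rewrite -size_poly_gt0 sf.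
  rewrite ltnS; apply/leq_sizeP => j; rewrite leq_eqVlt => /predU1P[<-|lt_mj].
    have e1 : (f : {poly K})`_m = c by rewrite /c lead_coefE sf.
    have e2 : (q0 * g : {poly K})`_m = c by rewrite -lq0 -lM lead_coefE sM' sf.
    by rewrite coefB e1 [X in _ - X]e2 subrr.
  rewrite coefB [X in X - _]nth_default ?sf // [X in _ - X]nth_default ?subrr //.
  by rewrite sM' sf.
have [q [r [e lt_r]]] := IHn _ (leq_trans lt le_fn).
exists (q + q0), r; split=> //.
by rewrite mulrDl addrAC -e subrK.
Qed.

Lemma ore_divides g f : g != 0 ->
  exists q r, f = q * g + r /\ (osize r < osize g)%N.
Proof.
move=> /monic_multiple[c [g' [c0 mg' <- ->]]].
have [q [r [-> lt_r]]] := ore_divides_monic f mg'.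
have [cV _] := oreC_unit c0.
by exists (q * oreC c^-1), r; rewrite mulrA -(mulrA q) cV mulr1.
Qed.

(** In a domain, a left inverse is two-sided. *)
Lemma unit_left_inverse u v : v * u = 1 -> ore_unit u.
Proof.
move=> vu1; exists v; split=> //.
have u0 : u != 0.
  by apply: contra_eq_neq vu1 => ->; rewrite mulr0 eq_sym oner_neq0.
by apply: (ore_mulIf u0); rewrite -mulrA vu1 mulr1 mul1r.
Qed.

Lemma in_left_ideal_id f : in_left_ideal f f.
Proof. by exists 1; rewrite mul1r. Qed.

Lemma in_left_ideal0 f : in_left_ideal f 0.
Proof. by exists 0; rewrite mul0r. Qed.

Lemma in_left_idealD f x y :
  in_left_ideal f x -> in_left_ideal f y -> in_left_ideal f (x + y).
Proof. by move=> [a ->] [b ->]; exists (a + b); rewrite mulrDl. Qed.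

Lemma in_left_idealM f x y : in_left_ideal f y -> in_left_ideal f (x * y).
Proof. by move=> [b ->]; exists (x * b); rewrite mulrA. Qed.

Lemma in_left_idealN f x : in_left_ideal f x -> in_left_ideal f (- x).
Proof. by move=> [a ->]; exists (- a); rewrite mulNr. Qed.

Lemma in_left_idealB f x y :
  in_left_ideal f x -> in_left_ideal f y -> in_left_ideal f (x - y).
Proof. by move=> fx fy; apply/in_left_idealD/in_left_idealN. Qed.

Lemma in_left_ideal_sum f (J : Type) (r : seq J) (P : pred J) (F : J -> ore D) :
  (forall i, P i -> in_left_ideal f (F i)) ->
  in_left_ideal f (\sum_(i <- r | P i) F i).
Proof. exact: (big_ind _ (in_left_ideal0 f) (@in_left_idealD f)). Qed.

Lemma in_left_ideal_small f x :
  f != 0 -> in_left_ideal f x -> (osize x < osize f)%N -> x = 0.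
Proof.
move=> f0 [q ->]; have [-> _|q0] := eqVneq q 0; first by rewrite mul0r.
rewrite osizeM // -(prednK (n := osize q)) ?size_poly_gt0 // addSn /=.
by rewrite ltnNge leq_addl.
Qed.

Definition left_ideal I :=
  [/\ I 0, forall x y, I x -> I y -> I (x + y) & forall x y, I y -> I (x * y)].

(** A nonzero element of minimal size generates, by division. *)
Lemma left_ideal_principal I : left_ideal I ->
  exists d, forall x, I x <-> in_left_ideal d x.
Proof.
move=> [I0 ID IM].
have small n d : (osize d < n)%N -> I d -> d != 0 ->
    exists d, forall x, I x <-> in_left_ideal d x.
  elim: n d => // n IHn d; rewrite ltnS => le_dn Id d0.
  case: (classic (exists y, [/\ I y, y != 0 & (osize y < osize d)%N])).
    by move=> [y [Iy y0 lt_yd]]; exact: (IHn y (leq_trans lt_yd le_dn)).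
  move=> min_d; exists d => x; split=> [Ix|[q ->]]; last exact: IM.
  have [q [r [e lt_rd]]] := ore_divides x d0.
  have [r0|r0] := eqVneq r 0; first by exists q; rewrite e r0 addr0.
  case: min_d; exists r; split=> //.
  have -> : r = x + - q * d by rewrite e mulNr addrAC subrr add0r.
  by apply: ID => //; apply: IM.
case: (classic (exists y, I y /\ y != 0)) => [[y [Iy y0]]|all0].
  exact: small (leqnn _) Iy y0.
exists 0 => x; split=> [Ix|[q ->]]; last by rewrite mulr0.
have [->|x0] := eqVneq x 0; first exact: in_left_ideal0.
by case: all0; exists x.
Qed.

(** The left ideal Rx + Rp is principal, and its generator divides p on the
    right: by irreducibility it is either a unit or an associate of p. *)
Lemma irreducible_maximal p x : ore_irreducible p -> ~ in_left_ideal p x ->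
  exists a b : ore D, 1 = a * x + b * p.
Proof.
move=> [p0 _ irr_p] npx.
have [|d dE] :=
    @left_ideal_principal (fun z => exists a b : ore D, z = a * x + b * p).
  split=> [|z y [a [b ->]] [a' [b' ->]]|z y [a [b ->]]].
  - by exists 0, 0; rewrite !mul0r addr0.
  - by exists (a + a'), (b + b'); rewrite !mulrDl addrACA.
  - by exists (z * a), (z * b); rewrite mulrDr !mulrA.
have [q pE] : in_left_ideal d p by apply/dE; exists 0, 1; rewrite mul0r mul1r add0r.
have [w xE] : in_left_ideal d x by apply/dE; exists 1, 0; rewrite mul0r mul1r addr0.
have [[q' [_ q'q]]|[d' [_ d'd]]] := irr_p _ _ pE; last by apply/dE; exists d'.
by case: npx; exists (w * q'); rewrite xE pE -mulrA (mulrA q') q'q mul1r.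
Qed.

Lemma irreducible_XsubC a : ore_irreducible (oreX - oreC a : ore D).
Proof.
have sX := osize_XsubC D a; have X0 := monic_ore_neq0 (monic_oreXsubC D a).
have const_unit u : osize u = 1 -> ore_unit u.
  move=> /eqP/size_poly1P[c c0 uE]; have [cV Vc] := oreC_unit c0.
  by exists (oreC c^-1); rewrite (uE : u = oreC c).
split=> // [[v [uv _]]|b c bc].
  have v0 : v != 0 by apply: contra_eq_neq uv => ->; rewrite mulr0 eq_sym oner_neq0.
  have := osizeM X0 v0; rewrite uv sX [LHS]size_poly1 add2n /= => -[/esym/eqP].
  by rewrite size_poly_eq0 (negPf v0).
have b0 : b != 0 by apply: contra_eq_neq bc => ->; rewrite mul0r.
have c0 : c != 0 by apply: contra_eq_neq bc => ->; rewrite mulr0.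
have := osizeM b0 c0; rewrite -bc sX.
move: (b0) (c0); rewrite -!size_poly_gt0.
case sb: (osize b) => [//|[|m]] _; first by left; apply: const_unit.
case sc: (osize c) => [//|[|n]] _; first by right; apply: const_unit.
by rewrite !addSn !addnS.
Qed.

(** * Fully reducible products *)

(** Lists replace families indexed by ordinals, so that families of maximal
    left ideals can be built by induction. *)
Lemma fully_reducible_seq f : fully_reducible f <->
  ore_monic f /\ exists ps : seq (ore D),
    (forall p, p \in ps -> ore_irreducible p) /\
    (forall x, in_left_ideal f x <-> forall p, p \in ps -> in_left_ideal p x).
Proof.
split=> -[mf]; last first.
  move=> [ps [irr fE]]; split=> //; exists (size ps), (tnth (in_tuple ps)).
  split=> [i|x]; first exact/irr/mem_tnth.
  split=> [/fE fx i|fx]; first exact/fx/mem_tnth.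
  by apply/fE => p /(tnthP (in_tuple ps))[i ->].
move=> [m [p [irr fE]]]; split=> //; exists (codom p).
split=> [_ /codomP[i ->] //|x]; split=> [/fE fx _ /codomP[i ->] //|fx].
by apply/fE => i; apply/fx/codom_f.
Qed.

(** The lattice form of complete reducibility: Rh has a complement L modulo the
    intersection of finitely many maximal left ideals Rp.  Start from L = R and
    intersect L with each Rp in turn, skipping the p such that Rp already
    contains the intersection of L and Rh.  The element w, in L and congruent
    to 1 modulo Rh, witnesses L + Rh = R. *)
Lemma complement_mod_maximals h (ps : seq (ore D)) :
  (forall p, p \in ps -> ore_irreducible p) ->
  exists L, [/\ left_ideal L, exists w, L w /\ in_left_ideal h (1 - w) &
    forall x, L x -> in_left_ideal h x -> forall p, p \in ps -> in_left_ideal p x].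
Proof.
elim: ps => [_|p ps IHps irr].
  exists (fun=> True); split=> //.
  by exists 1; split=> //; rewrite subrr; apply: in_left_ideal0.
have [|L [idL [w [Lw hw]] Lps]] := IHps.
  by move=> q ps_q; apply: irr; rewrite inE ps_q orbT.
case: (classic (forall x, L x -> in_left_ideal h x -> in_left_ideal p x)) => [Lp|].
  exists L; split=> // [|x Lx hx q]; first by exists w.
  by rewrite inE => /predU1P[->|]; [apply: Lp | apply: Lps].
move=> /not_all_ex_not[n0 nLp].
have [Ln0 nhp] := imply_to_and _ _ nLp.
have [hn0 npn0] := imply_to_and _ _ nhp.
have [a [b ab1]] := irreducible_maximal (irr p (mem_head _ _)) npn0.
have [L0 LD LM] := idL.
(* With 1 = a n0 + b p and n0 in both L and Rh, the element w b p lies in L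
   and in Rp, and differs from w by an element of Rh. *)
have wE : w * (b * p) = w - w * (a * n0).
  by rewrite -{2}[w]mulr1 ab1 mulrDr addrAC subrr add0r.
exists (fun x => L x /\ in_left_ideal p x); split.
- split=> [|x y [Lx px] [Ly py]|x y [Ly py]].
  + by split=> //; apply: in_left_ideal0.
  + by split; [apply: LD | apply: in_left_idealD].
  + by split; [apply: LM | apply: in_left_idealM].
- exists (w * (b * p)); split.
    split; last by apply/in_left_idealM/in_left_idealM/in_left_ideal_id.
    by rewrite wE -mulNr; apply: LD => //; apply/LM/LM.
  rewrite wE opprB addrCA addrC.
  exact/in_left_idealD/in_left_idealM/in_left_idealM.
move=> x [Lx px] hx q; rewrite inE => /predU1P[-> //|].
exact: Lps.
Qed.

(** With w = 1 - xh in a complement of Rh modulo Rgh, the element hw lies both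
    in Rh and in that complement, hence in Rgh. *)
Lemma coprime_of_fully_reducible_mul g h : h != 0 ->
  fully_reducible (g * h) -> exists u v, 1 = u * g + h * v.
Proof.
move=> h0 /fully_reducible_seq[_ [ps [irr ghE]]].
have [L [[_ _ LM] [w [Lw [x wE]]] Lps]] := complement_mod_maximals h irr.
have hw : h * w = (1 - h * x) * h.
  by rewrite mulrBl mul1r -mulrA -wE mulrBr mulr1 opprB addrC subrK.
have [y yE] : in_left_ideal (g * h) (h * w).
  by apply/ghE/Lps; [apply: LM | exists (1 - h * x)].
exists y, x; rewrite -[LHS](subrK (h * x)); congr (_ + _).
by apply: (ore_mulIf h0); rewrite -hw yE mulrA.
Qed.

(** The identity ug + hv = 1 makes z |-> (z, zv) an embedding of R/Rgh into
    R/Rh x R/Rg.  It is well defined because ghv = g(1 - ug) lies in Rg, and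
    injective because, for z = yh, the element zv = y - yug lies in Rg only if
    y does. *)
Lemma in_left_ideal_mul g h u v z : 1 = u * g + h * v ->
  in_left_ideal (g * h) z <-> in_left_ideal h z /\ in_left_ideal g (z * v).
Proof.
move=> uv1; have hvE : h * v = 1 - u * g by rewrite uv1 addrAC subrr add0r.
split=> [[y ->]|[[y ->]]].
  split; first by exists (y * g); rewrite mulrA.
  rewrite -!mulrA hvE !mulrBr mulr1; apply: in_left_idealB.
    exact/in_left_idealM/in_left_ideal_id.
  by rewrite !mulrA; apply/in_left_idealM/in_left_ideal_id.
rewrite -mulrA hvE mulrBr mulr1 => gy.
have [b ->] : in_left_ideal g y.
  rewrite -[y](subrK (y * (u * g))); apply: in_left_idealD => //.
  exact/in_left_idealM/in_left_idealM/in_left_ideal_id.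
by exists b; rewrite mulrA.
Qed.

(** The left ideal {x : xv in Rp} is the annihilator of the class of v in the
    simple module R/Rp; being the annihilator of a nonzero element, it is
    maximal.  The element x0 shows that it is not zero, so that its generator
    is a nonzero polynomial. *)
Lemma irreducible_pullback p v x0 : ore_irreducible p -> ~ in_left_ideal p v ->
  x0 != 0 -> in_left_ideal p (x0 * v) ->
  exists p', ore_irreducible p' /\
    forall x, in_left_ideal p' x <-> in_left_ideal p (x * v).
Proof.
move=> irr_p npv x00 px0v.
have [|p' p'E] := @left_ideal_principal (fun x => in_left_ideal p (x * v)).
  split=> [|x y px py|x y py]; first by rewrite mul0r; apply: in_left_ideal0.
    by rewrite mulrDl; apply: in_left_idealD.
  by rewrite -mulrA; apply: in_left_idealM.
have p'0 : p' != 0.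
  apply: contraNneq x00 => p'0; have /p'E[q ->] := px0v.
  by rewrite p'0 mulr0.
exists p'; split=> [|x]; last by rewrite p'E.
split=> // [[q [_ qp']]|a b p'ab].
  by apply: npv; rewrite -[v]mul1r; apply/p'E; exists q.
case: (classic (in_left_ideal p (b * v))) => [/p'E[c bE]|npbv].
  left; have b0 : b != 0 by apply: contraNneq p'0 => b0; rewrite p'ab b0 mulr0.
  apply: (@unit_left_inverse _ c); apply: (ore_mulIf b0).
  by rewrite -mulrA -p'ab -bE mul1r.
right; have [y [c ycE]] := irreducible_maximal irr_p npbv.
have [d dE] : in_left_ideal p' (1 - v * (y * b)).
  apply/p'E; exists (v * c); rewrite mulrBl mul1r -!mulrA.
  by rewrite -{1}[v]mulr1 ycE mulrDr addrAC subrr add0r.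
apply: (@unit_left_inverse _ (d * a + v * y)).
by rewrite mulrDl -!mulrA -p'ab -dE subrK.
Qed.

(** The p such that Rp contains v impose no condition on x; the others
    contribute one irreducible polynomial each. *)
Lemma pullback_maximals (ps : seq (ore D)) v x0 :
  (forall p, p \in ps -> ore_irreducible p) -> x0 != 0 ->
  (forall p, p \in ps -> in_left_ideal p (x0 * v)) ->
  exists ps' : seq (ore D), (forall p, p \in ps' -> ore_irreducible p) /\
    forall x, (forall p, p \in ps' -> in_left_ideal p x) <->
              (forall p, p \in ps -> in_left_ideal p (x * v)).
Proof.
move=> + x00; elim: ps => [|p ps IHps] irr px0v; first by exists [::].
have [|q ps_q|ps' [irr' psE]] := IHps.
- by move=> q ps_q; apply: irr; rewrite inE ps_q orbT.
- by apply: px0v; rewrite inE ps_q orbT.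
case: (classic (in_left_ideal p v)) => [pv|npv].
  exists ps'; split=> // x; rewrite psE; split=> psx q ps_q.
    by move: ps_q; rewrite inE => /predU1P[->|/psx //]; apply: in_left_idealM.
  by apply: psx; rewrite inE ps_q orbT.
have [p' [irr_p' p'E]] := irreducible_pullback (irr p (mem_head _ _)) npv x00
  (px0v p (mem_head _ _)).
exists (p' :: ps'); split=> [q|x]; first by rewrite inE => /predU1P[->|/irr'].
split=> psx q.
  rewrite inE => /predU1P[->|ps_q]; first exact/p'E/psx/mem_head.
  by apply/psE: q ps_q => r ps'_r; apply: psx; rewrite inE ps'_r orbT.
rewrite inE => /predU1P[->|ps'_q]; first exact/p'E/psx/mem_head.
by apply/psE: q ps'_q => r ps_r; apply: psx; rewrite inE ps_r orbT.
Qed.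

Lemma fully_reducible_mul g h u v :
  fully_reducible g -> fully_reducible h -> 1 = u * g + h * v ->
  fully_reducible (g * h).
Proof.
move=> /fully_reducible_seq[mg [ps [irr_ps gE]]].
move=> /fully_reducible_seq[mh [qs [irr_qs hE]]] uv1.
have [mgh _] := ore_monicM mg mh.
have [||ps' [irr_ps' ps'E]] := @pullback_maximals ps v (g * h) irr_ps.
- exact: monic_ore_neq0.
- apply/gE; have [_] := (in_left_ideal_mul (g * h) uv1).1 (in_left_ideal_id _).
  by [].
apply/fully_reducible_seq; split=> //; exists (qs ++ ps').
split=> [p|x]; first by rewrite mem_cat => /orP[/irr_qs|/irr_ps'].
rewrite (in_left_ideal_mul x uv1); split=> [[/hE hx /gE/ps'E gx] p|px].
  by rewrite mem_cat => /orP[/hx|/gx].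
split; first by apply/hE => p qs_p; apply: px; rewrite mem_cat qs_p.
by apply/gE/ps'E => p ps_p; apply: px; rewrite mem_cat ps_p orbT.
Qed.

(** * Wedderburn polynomials *)

Lemma vanishes_atE f a : vanishes_at f a <-> in_left_ideal (oreX - oreC a) f.
Proof. by split=> -[q ->]; exists q; rewrite raddf0 addr0. Qed.

(** The polynomials vanishing on V(f) form a left ideal containing f; minimality
    of the degree of f says that f generates it. *)
Lemma wedderburnP f : wedderburn f <-> ore_monic f /\
  forall x, (forall a, vanishes_at f a -> vanishes_at x a) -> in_left_ideal f x.
Proof.
split=> -[mf minf]; split=> // x; last first.
  move=> x0 /minf[q xE]; have q0 : q != 0.
    by apply: contraNneq x0 => q0; rewrite xE q0 mul0r.
  rewrite xE /deg osizeM ?(monic_ore_neq0 mf) //.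
  rewrite -(prednK (n := osize q)) ?size_poly_gt0 // addSn /= -!subn1.
  by apply: leq_sub2r; apply: leq_addl.
move=> fx; have f0 := monic_ore_neq0 mf.
have [q [r [xE lt_rf]]] := ore_divides x f0.
have [r0|r0] := eqVneq r 0; first by exists q; rewrite xE r0 addr0.
have : (deg f <= deg r)%N.
  apply: minf => // a fa; apply/vanishes_atE.
  have -> : r = x - q * f by rewrite xE addrAC subrr add0r.
  apply: in_left_idealB; first exact/vanishes_atE/fx.
  exact/in_left_idealM/vanishes_atE.
rewrite /deg leqNgt; case/negP; rewrite -ltnS prednK ?size_poly_gt0 //.
by rewrite prednK ?size_poly_gt0.
Qed.

(** Generators of the intersections of the R(t - a), for a in finite subsets of
    V(f), have size at most that of f.  As long as the generator d of such an
    intersection does not vanish on all of V(f), adding a point of V(f) where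
    it does not vanish strictly increases its size. *)
Lemma wedderburn_finite f : wedderburn f -> exists s : seq K,
  (forall a, a \in s -> vanishes_at f a) /\
  (forall x, (forall a, a \in s -> vanishes_at x a) -> in_left_ideal f x).
Proof.
move=> /wedderburnP[mf fE]; have f0 := monic_ore_neq0 mf.
suff grow n (s : seq K) d : (osize f - osize d < n)%N ->
    (forall a, a \in s -> vanishes_at f a) ->
    (forall x, (forall a, a \in s -> vanishes_at x a) <-> in_left_ideal d x) ->
    exists s : seq K, (forall a, a \in s -> vanishes_at f a) /\
    (forall x, (forall a, a \in s -> vanishes_at x a) -> in_left_ideal f x).
  apply: (grow (osize f).+1 [::] 1) => //; first by rewrite ltnS leq_subr.
  by move=> x; split=> // _; exists x; rewrite mulr1.
elim: n s d => // n IHn s d le_n fs dE.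
case: (classic (forall a, vanishes_at f a -> vanishes_at d a)) => [/fE[q dq]|].
  by exists s; split=> // x /dE[y ->]; exists (y * q); rewrite dq mulrA.
move=> /not_all_ex_not[a nfda]; have [fa nda] := imply_to_and _ _ nfda.
have [|d' d'E] := @left_ideal_principal
    (fun x => forall b, b \in a :: s -> vanishes_at x b).
  split=> [b _|x y sx sy b s_b|x y sy b s_b]; apply/vanishes_atE.
  - exact: in_left_ideal0.
  - by apply: in_left_idealD; apply/vanishes_atE; [apply: sx | apply: sy].
  - by apply/in_left_idealM/vanishes_atE/sy.
have fas b : b \in a :: s -> vanishes_at f b.
  by rewrite inE => /predU1P[->|/fs].
apply: (IHn (a :: s) d') => //.
have [c cE] : in_left_ideal d' f by apply/d'E.
have [e eE] : in_left_ideal d d'.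
  apply/dE => b s_b; have /d'E := in_left_ideal_id d'; apply.
  by rewrite inE s_b orbT.
have d'0 : d' != 0 by apply: contraNneq f0 => d'0; rewrite cE d'0 mulr0.
have c0 : c != 0 by apply: contraNneq f0 => c0; rewrite cE c0 mul0r.
have e0 : e != 0 by apply: contraNneq d'0 => e0; rewrite eE e0 mul0r.
have d0 : d != 0 by apply: contraNneq d'0 => d0; rewrite eE d0 mulr0.
have sf := osizeM c0 d'0; rewrite -cE in sf.
have sd' := osizeM e0 d0; rewrite -eE in sd'.
have lt_dd' : (osize d < osize d')%N.
  rewrite ltnNge; apply/negP => le_d'd; apply: nda; apply/vanishes_atE.
  have [q [r [dq lt_r]]] := ore_divides d d'0.
  have [r0|r0] := eqVneq r 0.
    rewrite dq r0 addr0; apply/in_left_idealM/vanishes_atE.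
    by have /d'E := in_left_ideal_id d'; apply; apply: mem_head.
  have dr : in_left_ideal d r.
    have -> : r = d - q * d' by rewrite [d in d - _]dq addrAC subrr add0r.
    apply: in_left_idealB; first exact: in_left_ideal_id.
    by rewrite eE mulrA; apply/in_left_idealM/in_left_ideal_id.
  by move: r0; rewrite (in_left_ideal_small d0 dr) ?eqxx //; apply: leq_trans le_d'd.
have le_d'f : (osize d' <= osize f)%N.
  by rewrite sf -(prednK (n := osize c)) ?size_poly_gt0 // addSn leq_addl.
rewrite -ltnS; apply: leq_trans le_n; rewrite ltnS ltn_sub2l //.
exact: leq_trans le_d'f.
Qed.

Lemma wedderburn_fully_reducible f : wedderburn f -> fully_reducible f.
Proof.
move=> Wf; have [s [fs sE]] := wedderburn_finite Wf.
apply/fully_reducible_seq; split; first by case: Wf.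
exists [seq oreX - oreC a | a <- s]; split=> [_ /mapP[a _ ->]|x].
  exact: irreducible_XsubC.
split=> [[q ->] _ /mapP[a s_a ->]|sx].
  by apply/in_left_idealM/vanishes_atE/fs.
by apply: sE => a s_a; apply/vanishes_atE/sx/map_f.
Qed.

(** Let c be the value of v at a.  If c is nonzero, then
    (t - a')c = S(c)(t - a) for the (S,D)-conjugate a' = (S(c)a + D(c))c^-1 of
    a, so xv vanishes at a exactly when x vanishes at a'. *)
Lemma linear_factor_pullback a v : ~ vanishes_at v a -> exists a', forall x,
  vanishes_at x a' <-> vanishes_at (x * v) a.
Proof.
have [c [[q vE] _]] := skew_eval_unique v a; move=> nva.
have c0 : c != 0 by apply: contra_notN nva => /eqP c0; exists q; rewrite vE c0.
have Uc := K_div c0; set p := oreX - oreC a in vE.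
pose a' := (S c * a + D c) * c^-1; exists a' => x; rewrite !vanishes_atE -/p.
have p'c : (oreX - oreC a') * oreC c = oreC (S c) * p.
  rewrite mulrBl oreXC mulrBr -!oreC_mul /a' divrK // oreCD.
  by rewrite opprD addrACA subrr addr0.
have xvE y : in_left_ideal p (y * v) <-> in_left_ideal p (y * oreC c).
  rewrite vE mulrDr mulrA; have py : in_left_ideal p (y * q * p).
    exact/in_left_idealM/in_left_ideal_id.
  split=> [pyv|]; last exact: in_left_idealD.
  by rewrite -[_ * oreC c](addKr (y * q * p)) addrC; apply: in_left_idealB.
rewrite xvE; split=> [[y ->]|].
  by rewrite -mulrA p'c; apply/in_left_idealM/in_left_idealM/in_left_ideal_id.
have [d [[y ->] _]] := skew_eval_unique x a'.
rewrite mulrDl -mulrA p'c -oreC_mul => pz.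
have /in_left_ideal_small dc0 : in_left_ideal p (oreC (d * c)).
  rewrite -[oreC _](addKr (y * (oreC (S c) * p))) addrC; apply: in_left_idealB => //.
  exact/in_left_idealM/in_left_idealM/in_left_ideal_id.
have dc_eq0 : d * c = 0.
  apply/eqP; rewrite -polyC_eq0; apply/eqP/dc0.
    exact/monic_ore_neq0/monic_oreXsubC.
  by rewrite osize_XsubC ltnS size_polyC_leq1.
have -> : d = 0 by rewrite -[d](mulrK Uc) dc_eq0 mul0r.
by rewrite raddf0 addr0; apply/in_left_idealM/in_left_ideal_id.
Qed.

Lemma wedderburn_mul g h u v :
  wedderburn g -> wedderburn h -> 1 = u * g + h * v -> wedderburn (g * h).
Proof.
move=> /wedderburnP[mg gE] /wedderburnP[mh hE] uv1.
have [mgh _] := ore_monicM mg mh.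
apply/wedderburnP; split=> // x ghx.
apply/(in_left_ideal_mul x uv1); split; [apply: hE => a ha | apply: gE => a ga].
  by apply/ghx/vanishes_atE/in_left_idealM/vanishes_atE.
case: (classic (vanishes_at v a)) => [va|/linear_factor_pullback[a' a'E]].
  exact/vanishes_atE/in_left_idealM/vanishes_atE.
apply/a'E/ghx/a'E/vanishes_atE.
have [_ [y ->]] := (in_left_ideal_mul (g * h) uv1).1 (in_left_ideal_id _).
exact/in_left_idealM/vanishes_atE.
Qed.

End OreOverDivisionRing.

(** * Frames and the matrix equation *)

Section Frames.
Variables (K : unitRingType) (K_div : is_division_ring K).
Variables (S : {rmorphism K -> K}) (D : sderivation S).
Implicit Types (f g h z u v : ore D) (l m n : nat).

Definition ore_mx m n (A : 'M[K]_(m, n)) : 'M[ore D]_(m, n) := map_mx oreC A.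

Definition corner_col n f : 'cV[ore D]_n := \col_i (if i.+1 == n then f else 0).

(** The column e is a basis of R/Rf adapted to the degree, and A is the matrix
    of left multiplication by t in this basis; the correction term lifts this
    relation from R/Rf to R.  Only the last row needs one, because
    t e_(n-1) has degree n. *)
Definition frame n (A : 'M[K]_n) f (e : 'cV[ore D]_n) :=
  [/\ ore_monic f /\ deg f = n,
      forall i, ore_monic (e i 0) /\ deg (e i 0) = i
    & oreX *: e = ore_mx A *m e + corner_col n f].

Lemma corner_colM n f z : corner_col n f *m z%:M = corner_col n (f * z).
Proof.
apply/matrixP=> i j; rewrite !mxE big_ord1 !mxE (ord1 j) eqxx mulr1n.
by case: ifP; rewrite ?mul0r.
Qed.

Lemma corner_colB n f g : corner_col n f - corner_col n g = corner_col n (f - g).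
Proof. by apply/matrixP=> i j; rewrite !mxE; case: ifP; rewrite ?subrr. Qed.

Lemma corner_mx_col m n (e : 'cV[ore D]_n) (j0 : 'I_n) : j0 = 0 :> nat ->
  ore_mx (corner_mx K m n) *m e = corner_col m (e j0 0).
Proof.
move=> j00; apply/matrixP=> i j; rewrite !mxE (bigD1 j0) //= big1 => [|k ne_k].
  rewrite addr0 !mxE j00 eqxx andbT (ord1 j).
  by case: (_ == m); rewrite ?rmorph1 ?rmorph0 ?mul1r ?mul0r.
have k0 : (k == 0 :> nat) = false by rewrite -j00 val_eqE (negPf ne_k).
by rewrite !mxE k0 andbF rmorph0 mul0r.
Qed.

(** The commutation rule ta = S(a)t + D(a), entrywise. *)
Lemma scale_oreX_mulmx m n (X : 'M[K]_(m, n)) (e : 'cV[ore D]_n) :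
  oreX *: (ore_mx X *m e) =
  ore_mx (map_mx S X) *m (oreX *: e) + ore_mx (map_mx D X) *m e.
Proof.
apply/matrixP=> i j; rewrite !mxE mulr_sumr -big_split; apply: eq_bigr => k _.
by rewrite !mxE mulrA oreXC mulrDl mulrA.
Qed.

(** The left-hand side of the matrix equation, applied to the frame e of g, is
    A z - t z with z = X e, up to left multiples of g. *)
Lemma frame_equation_lift n l (A : 'M[K]_n) (B : 'M[K]_l) g e (X : 'M[K]_(n, l)) :
  frame B g e ->
  ore_mx (A *m X - map_mx S X *m B - map_mx D X) *m e =
  ore_mx A *m (ore_mx X *m e) - oreX *: (ore_mx X *m e) +
  ore_mx (map_mx S X) *m corner_col l g.
Proof.
move=> [_ _ eE]; rewrite scale_oreX_mulmx eE mulmxDr.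
rewrite /ore_mx !map_mxB !map_mxM !mulmxBl !mulmxA.
by rewrite !opprD !addrA [RHS]addrAC; congr (_ + _); rewrite addrNK.
Qed.

Section OneFrame.
Variables (n : nat) (A : 'M[K]_n) (f : ore D) (e : 'cV[ore D]_n).
Hypothesis e_frame : frame A f e.

Let me i : ore_monic (e i 0). Proof. by case: e_frame => _ /(_ i)[]. Qed.
Let de i : osize (e i 0) = i.+1.
Proof. by rewrite osize_monic //; case: e_frame => _ /(_ i)[_ ->]. Qed.
Let e_coef i : (e i 0 : {poly K})`_i = 1.
Proof. by have /monicP := me i; rewrite lead_coefE de. Qed.

Lemma frame_first (i : 'I_n) : i = 0 :> nat -> e i 0 = 1.
Proof.
move=> i0; have := de i; rewrite i0 => /eqP/size_poly1P[c _ eE].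
by have := e_coef i; rewrite i0 eE coefC eqxx => ->.
Qed.

(** In particular (k = 0) the entries of a frame are linearly independent.  The
    coefficients c_j are killed from the top down: once those above j are zero,
    the coefficient of degree j of the sum is c_j. *)
Lemma frame_coef_eq0 (c : 'I_n -> K) k :
  (osize (\sum_j oreC (c j) * e j 0) <= k)%N ->
  forall j : 'I_n, (k <= j)%N -> c j = 0.
Proof.
move=> le_k j; move: {2}(n - j)%N (leqnn (n - j)) => d.
elim: d j => [|d IHd] j le_d le_kj.
  by move: le_d; rewrite leqn0 subn_eq0 leqNgt ltn_ord.
have: (\sum_j oreC (c j) * e j 0 : {poly K})`_j = 0.
  by rewrite nth_default // (leq_trans le_k).
rewrite coef_sum (bigD1 j) //= big1 => [|i ne_ij].
  by rewrite addr0 oreCM coefZ e_coef mulr1.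
rewrite oreCM coefZ; case: (ltngtP i j) => [lt_ij|lt_ji|/val_inj ij].
- by rewrite [X in _ * X]nth_default ?mulr0 // de.
- rewrite IHd ?mul0r //; last by apply: leq_trans le_kj (ltnW lt_ji).
  by rewrite -ltnS (leq_trans _ le_d) // ltn_sub2l.
- by rewrite ij eqxx in ne_ij.
Qed.

Lemma frame_span z : (osize z <= n)%N ->
  exists c : 'I_n -> K, z = \sum_j oreC (c j) * e j 0.
Proof.
suff span m : (m <= n)%N -> forall z, (osize z <= m)%N ->
    exists c : 'I_n -> K, z = \sum_j oreC (c j) * e j 0 by apply: (span n).
elim: m => {z}[|m IHm].
  move=> _ z; rewrite leqn0 size_poly_eq0 => /eqP ->; exists (fun=> 0).
  by rewrite big1 // => j _; rewrite raddf0 mul0r.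
move=> lt_mn z le_zm; pose i := Ordinal lt_mn; pose c := (z : {poly K})`_m.
have [|c' zE] := IHm (ltnW lt_mn) (z - oreC c * e i 0).
  apply/leq_sizeP => j; rewrite leq_eqVlt => /predU1P[<-|lt_mj].
    by rewrite coefB oreCM coefZ (e_coef i) mulr1 subrr.
  rewrite coefB [X in X - _]nth_default ?(leq_trans le_zm) //.
  by rewrite oreCM coefZ [X in _ * X]nth_default ?mulr0 ?subrr // de.
exists (fun j => c' j + (if j == i then c else 0)).
rewrite -[LHS](subrK (oreC c * e i 0)) zE.
under [RHS]eq_bigr do rewrite raddfD mulrDl.
rewrite big_split /=; congr (_ + _); rewrite (bigD1 i) //= eqxx big1 ?addr0 //.
by move=> j /negPf ->; rewrite raddf0 mul0r.
Qed.

(** Both t e_i and e_(i+1) are monic of degree i + 1, so their difference has no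
    component along e_(i+1) or any later entry. *)
Lemma frame_superdiag (i j : 'I_n) : (i < j)%N -> A i j = (j == i.+1 :> nat)%:R.
Proof.
move=> lt_ij; have lt_i1 : (i.+1 < n)%N by apply: leq_ltn_trans (ltn_ord j).
pose i1 := Ordinal lt_i1.
apply/eqP; rewrite -subr_eq0; apply/eqP.
apply: (@frame_coef_eq0 (fun j => A i j - (j == i.+1 :> nat)%:R) i.+1) lt_ij.
have -> : \sum_j oreC (A i j - (j == i.+1 :> nat)%:R) * e j 0
        = oreX * e i 0 - e i1 0.
  have [_ _ /matrixP/(_ i 0)] := e_frame.
  rewrite !mxE (ltn_eqF lt_i1) addr0 => ->.
  under eq_bigr do rewrite raddfB mulrBl.
  rewrite sumrB; congr (_ - _); first by apply: eq_bigr => k _; rewrite mxE.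
  rewrite (bigD1 i1) //= eqxx rmorph1 mul1r big1 ?addr0 // => k.
  by rewrite -val_eqE /= => /negPf ->; rewrite rmorph0 mul0r.
apply/leq_sizeP => k; rewrite leq_eqVlt => /predU1P[<-|lt_k].
  rewrite coefB (e_coef i1) oreXM coef_ore_tmul e_coef rmorph1.
  by rewrite [X in D X]nth_default ?de // raddf0 addr0 subrr.
rewrite coefB [X in X - _]nth_default; last first.
  by apply: leq_trans lt_k; apply: size_oreXM; rewrite de.
by rewrite [X in _ - X]nth_default ?de // subrr.
Qed.

End OneFrame.

(** The column z = X e_g is the image of e_h under a map of left R-modules
    R -> R/Rg, determined by z_0.  A solution X gives 1 + h z_0 in Rg;
    conversely, if ug + hv = 1, the rows of X are the coordinates of - e_i v
    modulo Rg. *)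
Lemma coprime_frame_equation n l (A : 'M[K]_n) (B : 'M[K]_l) g h eh eg :
  frame A h eh -> frame B g eg -> (0 < n)%N -> (0 < l)%N ->
  (exists u v, 1 = u * g + h * v) <->
  exists X : 'M[K]_(n, l),
    A *m X - map_mx S X *m B - map_mx D X = corner_mx K n l.
Proof.
move=> frA frB n0 l0; have [[mg dg] _ _] := frB; have [_ _ ehE] := frA.
have g0 := monic_ore_neq0 mg.
have sg : osize g = l.+1 by rewrite osize_monic ?dg.
pose k0 := Ordinal l0; pose i0 := Ordinal n0.
have cornerE : ore_mx (corner_mx K n l) *m eg = corner_col n 1.
  by rewrite (@corner_mx_col _ _ _ k0) // (frame_first frB).
have ehE' z :
    ore_mx A *m (eh *m z%:M) - oreX *: (eh *m z%:M) = - corner_col n (h * z).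
  by rewrite mulmxA scalemxAl ehE mulmxDl opprD addNKr corner_colM.
split=> [[u [v uv1]]|[X XE]].
  have: forall i, exists x : ('I_l -> K) * ore D,
      \sum_k oreC (x.1 k) * eg k 0 = - (eh i 0 * v) - x.2 * g.
    move=> i; have [q [r [E lt_r]]] := ore_divides K_div (- (eh i 0 * v)) g0.
    have [|c rE] := frame_span frB (z := r); first by rewrite -ltnS -sg.
    by exists (c, q); rewrite /= -rE E addrAC subrr add0r.
  move=> /fin_all_exists[x xE]; pose X := \matrix_(i, k) (x i).1 k.
  pose Q := \col_i (x i).2.
  have zE : ore_mx X *m eg = - (eh *m v%:M) - Q *m g%:M.
    apply/matrixP => i j; rewrite (ord1 j) !mxE !big_ord1 !mxE eqxx !mulr1n -xE.
    by apply: eq_bigr => k _; rewrite !mxE.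
  exists X; apply/eqP; rewrite -subr_eq0; apply/eqP; set M := _ - corner_mx _ _ _.
  pose W := ore_mx (map_mx S X) *m corner_col l 1 - corner_col n u
            - (ore_mx A *m Q - oreX *: Q).
  (* The entries of M e_g are left multiples of g of size at most l, hence
     zero. *)
  have ME : ore_mx M *m eg = W *m g%:M.
    rewrite /M /ore_mx map_mxB mulmxBl -!/(ore_mx _) cornerE.
    rewrite (frame_equation_lift _ _ frB) zE /W !mulmxBl -!mulmxA !corner_colM mul1r.
    have -> : u * g = 1 - h * v by rewrite uv1 addrK.
    rewrite -corner_colB.
    have -> : corner_col n (h * v) = oreX *: (eh *m v%:M) - ore_mx A *m (eh *m v%:M).
      by rewrite -[LHS]opprK -ehE' opprB.
    rewrite mulmxBr mulmxN scalerBr scalerN -scalemxAl.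
    rewrite !opprD !opprK !addrA.
    by rewrite [LHS](ACl (5*6*3*1*2*4)%AC).
  apply/matrixP => i k; rewrite [RHS]mxE.
  apply: (frame_coef_eq0 frB (c := M i) (k := 0)) => //.
  rewrite leqn0 size_poly_eq0; apply/eqP; set w := \sum_j _.
  have wE : w = W i 0 * g.
    transitivity ((ore_mx M *m eg) i 0).
      by rewrite mxE; apply: eq_bigr => j _; rewrite [ore_mx M _ _]mxE.
    by rewrite ME mxE big_ord1 [X in _ * X]mxE eqxx mulr1n.
  apply: (in_left_ideal_small K_div g0); first by exists (W i 0).
  rewrite sg ltnS; apply: leq_trans (size_sum _ _ _) _; apply/bigmax_leqP => j _.
  apply: leq_trans (size_oreCM _ _) _; have [_ /(_ j)[mj dj] _] := frB.
  by rewrite (osize_monic mj) dj.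
pose z := ore_mx X *m eg; pose y := z - eh *m (z i0 0)%:M.
have yE : ore_mx A *m y - oreX *: y
    = corner_col n (1 + h * z i0 0) - ore_mx (map_mx S X) *m corner_col l g.
  have := frame_equation_lift A X frB; rewrite XE cornerE => zE.
  rewrite mulmxBr scalerBr opprD addrACA -opprD ehE' opprK.
  rewrite -/z in zE.
  rewrite -[X in X + _](addrK (ore_mx (map_mx S X) *m corner_col l g)) -zE.
  rewrite addrAC; congr (_ - _); apply/matrixP=> i j; rewrite !mxE.
  by case: ifP; rewrite ?addr0.
have rowE (i : 'I_n) : in_left_ideal g (\sum_j oreC (A i j) * y j 0
    - oreX * y i 0 - (if i.+1 == n then 1 + h * z i0 0 else 0)).
  have /matrixP/(_ i 0) := yE.
  have -> : corner_col l g = corner_col l 1 *m g%:M by rewrite corner_colM mul1r.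
  rewrite mulmxA; move: (_ *m corner_col _ _) => V.
  have -> : (ore_mx A *m y - oreX *: y) i 0
      = \sum_j oreC (A i j) * y j 0 - oreX * y i 0.
    by rewrite !mxE; congr (_ - _); apply: eq_bigr => j _; rewrite [ore_mx A _ _]mxE.
  move=> ->; rewrite !mxE [X in in_left_ideal g X]addrAC subrr add0r.
  rewrite big_ord1 mxE eqxx mulr1n.
  by exists (- V i 0); rewrite mulNr.
(* Row i of the equation for y expresses y_(i+1) in terms of y_0, ..., y_i
   modulo Rg, because A has ones above its diagonal and zeros beyond. *)
have yg m : forall i : 'I_n, (i <= m)%N -> in_left_ideal g (y i 0).
  elim: m => [|m IHm] i; first rewrite leqn0 => /eqP i00.
    have -> : i = i0 by apply: val_inj.
    rewrite !mxE big_ord1 (frame_first frA) // mxE eqxx mulr1n mul1r subrr.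
    exact: in_left_ideal0.
  rewrite leq_eqVlt => /predU1P[im|]; last exact: IHm.
  have lt_mn : (m < n)%N by apply: leq_trans (ltn_ord i); rewrite im.
  pose i' := Ordinal lt_mn; have := rowE i'.
  have -> : (i'.+1 == n) = false by rewrite -im (ltn_eqF (ltn_ord i)).
  rewrite subr0 (bigD1 i) //= (frame_superdiag frA (i := i')) ?im //= eqxx.
  rewrite rmorph1 mul1r.
  rewrite -addrA => gyi; rewrite -[y i 0](addrK
    (\sum_(j < n | j != i) oreC (A i' j) * y j 0 - oreX * y i' 0)).
  apply: in_left_idealB => //; apply: in_left_idealB; last first.
    exact/in_left_idealM/IHm.
  apply: in_left_ideal_sum => j ne_ji; have [le_jm|lt_mj] := leqP j m.
    exact/in_left_idealM/IHm.
  rewrite (frame_superdiag frA) //= -im val_eqE (negPf ne_ji) rmorph0 mul0r.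
  exact: in_left_ideal0.
(* With all the y_i in Rg, the last row leaves only 1 + h z_0. *)
have lt_n1 : (n.-1 < n)%N by rewrite ltn_predL.
have := rowE (Ordinal lt_n1); rewrite /= prednK // eqxx => g1.
have [w wE] : in_left_ideal g (1 + h * z i0 0).
  rewrite -[_ + _]opprK; apply: in_left_idealN.
  rewrite -[- _](addKr (\sum_j oreC (A (Ordinal lt_n1) j) * y j 0
                        - oreX * y (Ordinal lt_n1) 0)).
  apply: in_left_idealD => //; apply: in_left_idealN; apply: in_left_idealB.
    by apply: in_left_ideal_sum => j _; apply: in_left_idealM; apply: (yg j).
  by apply: in_left_idealM; apply/(yg n)/leq_pred.
by exists w, (- z i0 0); rewrite -wE mulrN addrK.
Qed.

(** * Frames of the companion matrices *)

Lemma oreX_expE i : oreX ^+ i = ('X^i : {poly K}) :> ore D.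
Proof.
elim: i => [|i IHi]; first by rewrite expr0.
by rewrite exprS IHi oreXM; apply: ore_tmulXn.
Qed.

Lemma monic_oreX_exp i :
  ore_monic (oreX ^+ i : ore D) /\ deg (oreX ^+ i : ore D) = i.
Proof.
by rewrite oreX_expE; split; [apply: monicXn | rewrite /deg size_polyXn].
Qed.

Lemma companion_frame f : ore_monic f ->
  frame (companion f) f (\col_i oreX ^+ i).
Proof.
move=> mf; split=> // [i|]; first by rewrite mxE; apply: monic_oreX_exp.
apply/matrixP=> i j; rewrite !mxE -exprS; have [fi|nfi] := eqVneq i.+1 (deg f).
  have fE : f = \sum_(k < deg f) oreC (f : {poly K})`_k * oreX ^+ k + oreX ^+ deg f.
    rewrite {1}[f]ore_sumE osize_monic // big_ord_recr /=; congr (_ + _).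
    have -> : (f : {poly K})`_(deg f) = 1 by rewrite -(monicP mf) lead_coefE.
    by rewrite rmorph1 mul1r.
  rewrite [X in _ + X]fE addrA fi -[LHS]add0r; congr (_ + _).
  rewrite -big_split big1 // => k _ /=.
  by rewrite !mxE fi eqxx rmorphN mulNr addNr.
have lt_i1 : (i.+1 < deg f)%N by rewrite ltn_neqAle nfi ltn_ord.
rewrite addr0 (bigD1 (Ordinal lt_i1)) //=.
rewrite big1 => [|k ne_k]; rewrite !mxE (negPf nfi).
  by rewrite eqxx rmorph1 mul1r addr0.
by move: ne_k; rewrite -val_eqE /= => /negPf ->; rewrite rmorph0 mul0r.
Qed.

Section PartialProducts.
Variables (r : nat) (p : 'I_r -> ore D).
Hypothesis mp : forall i, ore_monic (p i).

(** Extending the family by 1 beyond r makes the partial products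
    p_(k-1) ... p_0 satisfy a recurrence in the natural number k. *)
Definition factor_at k : ore D := if insub k is Some i then p i else 1.

Definition partial_prod k : ore D := \prod_(i < k) factor_at (k - i.+1).

Lemma factor_atE (i : 'I_r) : factor_at i = p i.
Proof. by rewrite /factor_at valK. Qed.

Lemma partial_prod0 : partial_prod 0 = 1.
Proof. exact: big_ord0. Qed.

Lemma partial_prodS k : partial_prod k.+1 = factor_at k * partial_prod k.
Proof. by rewrite /partial_prod big_ord_recl subn1. Qed.

Lemma partial_prod_full : partial_prod r = \prod_(i < r) p (rev_ord i).
Proof. by apply: eq_bigr => i _; rewrite -factor_atE. Qed.

Lemma partial_prod_monic k : ore_monic (partial_prod k) /\
  deg (partial_prod k) = (\sum_(i < k) deg (factor_at i))%N.
Proof.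
elim: k => [|k [mk dk]].
  rewrite partial_prod0 big_ord0.
  by split; [apply: monic1 | rewrite /deg size_poly1].
have mf : ore_monic (factor_at k).
  by rewrite /factor_at; case: insub => [i|]; [apply: mp | apply: monic1].
have [mM dM] := ore_monicM mf mk.
by rewrite partial_prodS dM dk big_ord_recr /= addnC.
Qed.

Lemma partial_prod_deg k : (k <= r)%N ->
  deg (partial_prod k) = (\sum_(i < r | (i < k)%N) deg (p i))%N.
Proof.
move=> le_kr; have [_ ->] := partial_prod_monic k.
rewrite (big_ord_widen r (fun i => deg (factor_at i))) //.
by apply: eq_bigr => i _; rewrite factor_atE.
Qed.

(** The basis t^j p_(i-1) ... p_0, with j < deg p_i.  Inside block i the
    relation is that of the companion matrix of p_i, multiplied on the right by
    p_(i-1) ... p_0; the correction term of that relation is p_i ... p_0, the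
    first basis vector of block i + 1, which accounts for the corner block. *)
Lemma block_companion_frame : (forall i, (0 < deg (p i))%N) ->
  frame (block_companion p) (partial_prod r)
    (\mxcol_i ((\col_(j < deg (p i)) oreX ^+ j) *m (partial_prod i)%:M)).
Proof.
move=> p_pos; split.
- split; first by case: (partial_prod_monic r).
  by rewrite partial_prod_deg //; apply: eq_bigl => i; rewrite ltn_ord.
- move=> s; rewrite !mxE big_ord1 !mxE eqxx mulr1n.
  have [mX dX] := monic_oreX_exp (tagnat.sig2 s).
  have [mQ _] := partial_prod_monic (tagnat.sig1 s).
  have [mM ->] := ore_monicM mX mQ; split=> //.
  by rewrite dX partial_prod_deg ?(ltnW (ltn_ord _)) // addnC [RHS]tagnat.rect.
set E := fun i : 'I_r => _ *m _.
(* No block is empty, so the last index lies in the last block. *)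
have cornerE : corner_col (\sum_i deg (p i)) (partial_prod r) =
    \mxcol_i (if i.+1 == r then corner_col (deg (p i)) (partial_prod r) else 0).
  apply/matrixP => t j; rewrite !mxE (ord1 j).
  have sumE : (\sum_i deg (p i) =
      \sum_(i < r | (i < tagnat.sig1 t)%N) deg (p i) +
      (deg (p (tagnat.sig1 t)) +
       \sum_(i < r | (tagnat.sig1 t < i)%N) deg (p i)))%N.
    rewrite (bigID (fun i : 'I_r => (i < tagnat.sig1 t)%N)) /=; congr (_ + _)%N.
    rewrite (bigD1 (tagnat.sig1 t)) ?ltnn //=; congr (_ + _)%N.
    by apply: eq_bigl => i; rewrite -leqNgt -val_eqE /= ltn_neqAle andbC eq_sym.
  have -> : (t.+1 == \sum_i deg (p i))%N = ((tagnat.sig2 t).+1 ==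
      deg (p (tagnat.sig1 t)) + \sum_(i < r | (tagnat.sig1 t < i)%N) deg (p i))%N.
    by rewrite [X in _ == X]sumE [X in X.+1 == _](tagnat.rect t) -addnS eqn_add2l.
  have [i1r|ni1r] := eqVneq (tagnat.sig1 t).+1 r.
    rewrite big_pred0 ?addn0 ?mxE // => i.
    by apply: negbTE; rewrite -leqNgt -ltnS i1r ltn_ord.
  have lt_i1 : ((tagnat.sig1 t).+1 < r)%N by rewrite ltn_neqAle ni1r ltn_ord.
  rewrite mxE ltn_eqF // (bigD1 (Ordinal lt_i1)) //=.
  apply: leq_ltn_trans (ltn_ord (tagnat.sig2 t)) _.
  by rewrite -[X in (X < _)%N]addn0 ltn_add2l ltn_addr.
have blockE : ore_mx (block_companion p) = \mxdiag_i ore_mx (companion (p i))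
    + \mxblock_(i, j) (if j == i.+1 :> nat
        then ore_mx (corner_mx K (deg (p i)) (deg (p j))) else 0).
  rewrite /ore_mx map_mxD; congr (_ + _); apply/matrixP => t s; rewrite !mxE.
    have [ts|_] := eqVneq; last by rewrite !mxE raddf0.
    move: (tagnat.sig2 t) (tagnat.sig2 s); rewrite ts => x y.
    by rewrite !conform_mx_id [RHS]mxE.
  by case: ifP => _; rewrite !mxE ?raddf0.
rewrite blockE cornerE mulmxDl mul_mxdiag_mxcol mul_mxblock_mxrow -!mxcolD.
have -> : oreX *: (\mxcol_i E i) = \mxcol_i (oreX *: E i).
  by apply/matrixP => i j; rewrite !mxE.
apply/eq_mxcol => i.
have [_ _ eE] := companion_frame (mp i).
rewrite /E scalemxAl eE mulmxDl -mulmxA -addrA; congr (_ + _).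
rewrite corner_colM -[X in corner_col _ (X * _)]factor_atE -partial_prodS.
have [i1r|ni1r] := eqVneq i.+1 r.
  rewrite big1 ?add0r ?i1r // => j _.
  by rewrite (ltn_eqF (ltn_ord j)) mul0mx.
have lt_i1 : (i.+1 < r)%N by rewrite ltn_neqAle ni1r ltn_ord.
rewrite addr0 (bigD1 (Ordinal lt_i1)) //= eqxx big1 ?addr0 => [|j]; last first.
  by rewrite -val_eqE /= => /negPf ->; rewrite mul0mx.
rewrite (@corner_mx_col _ _ _ (Ordinal (p_pos (Ordinal lt_i1)))) //.
by rewrite mxE big_ord1 !mxE expr0 mul1r eqxx mulr1n.
Qed.

End PartialProducts.

(** The basis (t - a_(i-1)) ... (t - a_0). *)
Lemma linear_companion_frame n (a : 'I_n -> K) :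
  let q i := oreX - oreC (a i) in
  frame (linear_companion a) (partial_prod q n) (\col_i partial_prod q i).
Proof.
move=> q; have mq i : ore_monic (q i) by apply: monic_oreXsubC.
have dq k : (k <= n)%N -> ore_monic (partial_prod q k) /\ deg (partial_prod q k) = k.
  move=> le_kn; have [mk _] := partial_prod_monic mq k; split=> //.
  rewrite partial_prod_deg // (eq_bigr (fun=> 1%N)) => [|i _].
    rewrite -(big_ord_widen n (fun=> 1%N)) //.
    by rewrite sum_nat_const card_ord muln1.
  by rewrite /deg osize_XsubC.
split=> [|i|]; first exact: dq; first by rewrite mxE; apply: dq; apply: ltnW.
apply/matrixP=> i j; rewrite !mxE.
have tE : oreX * partial_prod q i =
    oreC (a i) * partial_prod q i + partial_prod q i.+1.
  by rewrite partial_prodS factor_atE mulrBl addrC subrK.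
have -> : \sum_k ore_mx (linear_companion a) i k * (\col_i0 partial_prod q i0) k j =
    oreC (a i) * partial_prod q i + (if i.+1 == n then 0 else partial_prod q i.+1).
  rewrite (eq_bigr (fun k : 'I_n => (oreC (a i) *+ (i == k)) * partial_prod q k
      + (k == i.+1 :> nat)%:R * partial_prod q k)); last first.
    move=> k _; rewrite !mxE rmorphD mulrDl raddfMn; congr (_ + _ * _).
    exact: (rmorph_nat (@oreC K S D)).
  rewrite big_split /=; congr (_ + _).
    rewrite (bigD1 i) //= eqxx mulr1n big1 ?addr0 // => k.
    by rewrite eq_sym => /negPf ->; rewrite mulr0n mul0r.
  have [i1n|ni1n] := eqVneq i.+1 n.
    by rewrite big1 // => k _; rewrite i1n (ltn_eqF (ltn_ord k)) mul0r.
  have lt_i1 : (i.+1 < n)%N by rewrite ltn_neqAle ni1n ltn_ord.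
  rewrite (bigD1 (Ordinal lt_i1)) //= eqxx mul1r big1 ?addr0 // => k.
  by rewrite -val_eqE /= => /negPf ->; rewrite mul0r.
by rewrite tE -addrA; congr (_ + _); case: eqVneq => [->|_]; rewrite ?add0r ?addr0.
Qed.

End Frames.

Theorem theorem5p3
  (K : unitRingType) (K_div : is_division_ring K)
  (S : {rmorphism K -> K}) (D : sderivation S) (g h : ore D)
  (g_pos : (1 <= deg g)%N) (h_pos : (1 <= deg h)%N) :
  (fully_reducible g -> fully_reducible h ->
   forall (r s : nat) (p : 'I_r -> ore D) (q : 'I_s -> ore D),
     (forall i, ore_monic (p i) /\ (0 < deg (p i))%N) ->
     (forall i, ore_monic (q i) /\ (0 < deg (q i))%N) ->
     g = \prod_(i < r) p (rev_ord i) ->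
     h = \prod_(i < s) q (rev_ord i) ->
     [<-> fully_reducible (g * h);
          exists u v : ore D, 1 = u * g + h * v;
          exists X : 'M[K]_(deg h, deg g),
            companion h *m X - map_mx S X *m companion g - map_mx D X
            = corner_mx K (deg h) (deg g);
          exists Y : 'M[K]_(\sum_(i < s) deg (q i), \sum_(i < r) deg (p i)),
            block_companion q *m Y - map_mx S Y *m block_companion p
              - map_mx D Y
            = corner_mx K (\sum_(i < s) deg (q i)) (\sum_(i < r) deg (p i))])
  /\
  (wedderburn g -> wedderburn h ->
   forall (l n : nat) (b : 'I_l -> K) (a : 'I_n -> K),
     g = \prod_(i < l) (oreX - oreC (b (rev_ord i))) ->
     h = \prod_(i < n) (oreX - oreC (a (rev_ord i))) ->
     [<-> wedderburn (g * h);
          exists u v : ore D, 1 = u * g + h * v;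
          exists X : 'M[K]_(deg h, deg g),
            companion h *m X - map_mx S X *m companion g - map_mx D X
            = corner_mx K (deg h) (deg g);
          exists Y : 'M[K]_(n, l),
            linear_companion a *m Y - map_mx S Y *m linear_companion b
              - map_mx D Y
            = corner_mx K n l]).
Proof.
split=> [gR hR r s p q p_monic q_monic gE hE|gW hW l n b a gE hE].
  have [[mg _] [mh _]] := (gR, hR).
  have := block_companion_frame (fun i => (p_monic i).1)
    (fun i => (p_monic i).2).
  have := block_companion_frame (fun i => (q_monic i).1)
    (fun i => (q_monic i).2).
  rewrite !partial_prod_full -gE -hE => frQ frP.
  have [[_ dg] _ _] := frP; have [[_ dh] _ _] := frQ.
  have C3 := coprime_frame_equation K_div (companion_frame mh)
  (companion_frame mg) h_pos g_pos.
  have [||C4 C4'] := coprime_frame_equation K_div frQ frP; rewrite -?dg -?dh //.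
  tfae.
  - exact/(coprime_of_fully_reducible_mul K_div)/monic_ore_neq0.
  - by move/C3.
  - by move/C3/C4.
  - by move/C4' => [u [v]]; apply: fully_reducible_mul.
have [[mg _] [mh _]] := (gW, hW).
have := linear_companion_frame D b; have := linear_companion_frame D a.
rewrite /= !partial_prod_full -gE -hE => frA frB.
have [[_ dg] _ _] := frB; have [[_ dh] _ _] := frA.
have C3 := coprime_frame_equation K_div (companion_frame mh)
  (companion_frame mg) h_pos g_pos.
have [||C4 C4'] := coprime_frame_equation K_div frA frB; rewrite -?dg -?dh //.
tfae.
- move/(wedderburn_fully_reducible K_div).
  exact/(coprime_of_fully_reducible_mul K_div)/monic_ore_neq0.
- by move/C3.
- by move/C3/C4.
- by move/C4' => [u [v]]; apply: wedderburn_mul.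
Qed.
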